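(* Let $r\ge 3$ and $k\ge 1$ be integers. Every family $\mathcal{F}$ of $k$-sets with VC-dimension $1$ and $|\mathcal{F}|\ge r^{10k}$ contains an $r$-sunflower. That is, $f^1_r(k)\le r^{10k}$.
   Context: A $k$-set is a set with exactly $k$ elements. A family is a collection of pairwise distinct sets. An $r$-sunflower is a collection of $r$ distinct sets $S_1,\ldots,S_r$ such that $S_i\cap S_j=S_{i'}\cap S_{j'}$ for all $i\ne j$ and $i'\ne j'$. The VC-dimension of a family $\mathcal{F}$ of subsets of a ground set $V$ is the maximum $d$ for which there is a $d$-element set $S\subset V$ such that for every $B\subset S$ there is $A\in\mathcal{F}$ with $A\cap S=B$. For $d\ge 1$, $f^d_r(k)$ denotes the least positive integer $m$ such that every family $\mathcal{F}$ of $k$-sets with $|\mathcal{F}|\ge m$ and VC-dimension at most $d$ contains an $r$-sunflower. *)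

(* Defs.v *)
From mathcomp Require Import all_boot finmap.
From mathcomp Require Import boolp classical_sets functions cardinality.

Set Implicit Arguments.
Unset Strict Implicit.
Unset Printing Implicit Defensive.

Local Open Scope fset_scope.
Local Open Scope classical_set_scope.

(* The ground set V and the families F are arbitrary, possibly infinite; only
   the members of F are finite. *)

Definition uniform_family (V : choiceType) (k : nat) (F : set {fset V}) : Prop :=
  forall A, F A -> #|` A| = k.

Definition card_at_least (T : Type) (F : set T) (m : nat) : Prop :=
  (`I_m #<= F)%card.

Definition sunflower (V : choiceType) (r : nat) (S : 'I_r -> {fset V}) : Prop :=
  injective S /\
  forall i j i' j' : 'I_r, i != j -> i' != j' ->
    (S i `&` S j = S i' `&` S j')%fset.

Definition has_sunflower (V : choiceType) (r : nat) (F : set {fset V}) : Prop :=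
  exists S : 'I_r -> {fset V}, (forall i, F (S i)) /\ sunflower S.

Definition shatters (V : choiceType) (F : set {fset V}) (S : {fset V}) : Prop :=
  forall B : {fset V}, (B `<=` S)%fset ->
    exists A : {fset V}, F A /\ (A `&` S)%fset = B.

(* A relation, since no maximum exists when F is empty or shatters arbitrarily
   large sets. *)
Definition vc_dim (V : choiceType) (F : set {fset V}) (d : nat) : Prop :=
  (exists S : {fset V}, #|` S| = d /\ shatters F S) /\
  (forall S : {fset V}, shatters F S -> #|` S| <= d).

Definition vc_dim_at_most (V : choiceType) (F : set {fset V}) (d : nat) : Prop :=
  exists e : nat, vc_dim F e /\ e <= d.

Definition forces_sunflower (d r k m : nat) : Prop :=
  forall (V : choiceType) (F : set {fset V}),
    uniform_family k F -> card_at_least F m -> vc_dim_at_most F d ->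
    has_sunflower r F.

(* [sunflower_number d r k m] says that f^d_r(k) exists and equals m. *)
Definition sunflower_number (d r k m : nat) : Prop :=
  [/\ 0 < m, forces_sunflower d r k m &
      forall m', 0 < m' -> forces_sunflower d r k m' -> m <= m'].

(* Main.v *)
Require Import Defs.
From mathcomp Require Import all_boot finmap.
From mathcomp Require Import boolp classical_sets functions cardinality.

(** Fix a member [A0] of the family.  A family of [k]-sets has at most [2 ^ k]
    traces [A `&` A0], so a large family contains a large class of members with
    one common trace [T] ([fset_pigeonhole]).  The VC-dimension enters only
    through pairs of points [x], [y] outside [A0].  Since [A0] meets [{x, y}] in
    the empty set and [{x, y}] is not shattered, the patterns containing both
    points, only [x], and only [y] cannot all occur among the members
    ([laminar_off_member]).  So, within the class, the sets of members through
    [x] and through [y] are disjoint or nested: the parts of the members outside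
    [A0] are root paths of a forest, and they all have the same length
    [n <= k].

    In such a forest the bound is elementary.  All the paths that meet a given
    one pass through its root ([laminar_root]).  Among more than [s ^ n.+1]
    paths, choosing a path and removing all those through its root, repeatedly,
    yields either [s.+1] pairwise disjoint paths, which give a sunflower with
    kernel [T], or a root common to more than [s ^ n] paths
    ([sunflower_or_large_star]).  In the second case this root is added to the
    kernel and the common length of the paths drops by one.  Hence more than
    [s ^ n] members force a sunflower with [s.+1] petals ([laminar_sunflower]).

    With [s = r.-1], more than [2 ^ k * r.-1 ^ k] members suffice, and this
    number is smaller than [r ^ (10 * k)]. *)

Section LaminarSunflower.

Local Open Scope fset_scope.

(** * Counting in finite sets *)

Lemma cardfs_sepC (T : choiceType) (p : pred T) (D : {fset T}) :
  #|` D| = (#|` [fset x in D | p x]| + #|` [fset x in D | ~~ p x]|)%N.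
Proof.
rewrite -(cardfsID [fset x in D | p x] D).
by congr (_ + _)%N; congr #|` _|; apply/fsetP => x; rewrite !inE /=;
  case: (x \in D); case: (p x).
Qed.

Lemma fset_pigeonhole (T U : choiceType) (f : T -> U) (D : {fset T})
    (E : {fset U}) (m : nat) :
  (forall x, x \in D -> f x \in E) -> #|` E| * m < #|` D| ->
  exists y, m < #|` [fset x in D | f x == y]|.
Proof.
elim/finSet_rect: E D => E IH D fDE ltD.
case: (fset_0Vmem E) => [E0 | [y yE]].
  have [D0 | [x xD]] := fset_0Vmem D; first by rewrite D0 cardfs0 in ltD.
  by have := fDE x xD; rewrite E0 inE.
have [lt_m | le_m] := ltnP m #|` [fset x in D | f x == y]|; first by exists y.
case: (IH (E `\ y) _ [fset x in D | f x != y]).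
- exact: fproperD1.
- by move=> x; rewrite !inE /= => /andP[/fDE -> ->].
- move: ltD; rewrite (cardfsD1 y E) yE mulnDl mul1n.
  rewrite (cardfs_sepC _ (fun x => f x == y)) => ltD.
  by rewrite -(ltn_add2l m); apply: leq_trans ltD _; rewrite leq_add2r.
move=> z lt_m; exists z; apply: leq_trans lt_m _; apply: fsubset_leq_card.
by apply/fsubsetP => x; rewrite !inE /= => /andP[/andP[-> _] ->].
Qed.

(** * Sunflowers in laminar families *)

Variable V : choiceType.
Implicit Types (G H P : {fset {fset V}}) (A B C D K : {fset V}).

Definition star G (x : V) := [fset A in G | x \in A].

(** This says that any two stars [star G x] and [star G y] are disjoint or
    nested; the form below is the one that non-shattering provides. *)
Definition laminar G := forall x y A B C, A \in G -> B \in G -> C \in G ->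
  x \in A -> y \in A -> x \in B -> y \notin B -> x \notin C -> y \in C -> False.

Definition fsunflower P K :=
  forall A B, A \in P -> B \in P -> A != B -> A `&` B = K.

Lemma laminar_sub G H : H `<=` G -> laminar G -> laminar H.
Proof.
move=> /fsubsetP sHG lamG x y A B C /sHG GA /sHG GB /sHG GC.
exact: lamG GA GB GC.
Qed.

(** The stars of the points of [D] all contain [A], so they form a chain; the
    point [x] is one whose star is largest. *)
Lemma laminar_root G A D :
  laminar G -> A \in G -> D `<=` A -> D != fset0 ->
  exists2 x, x \in D &
    forall B y, B \in G -> y \in D -> y \in B -> x \in B.
Proof.
move=> lamG GA /fsubsetP sDA /fset0Pn[x0 Dx0].
pose n (x : D) := #|` star G (val x)|.
case: (arg_maxnP n (isT : xpredT [` Dx0])) => x _ max_x.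
exists (val x); first exact: valP.
move=> B y GB Dy By; apply/negPn/negP => nBx.
have := max_x [` Dy] isT; rewrite /n /= leqNgt => /negP[].
apply: fproper_ltn_card; rewrite fproperE; apply/andP; split.
  apply/fsubsetP => C; rewrite !inE /= => /andP[GC Cx]; rewrite GC /=.
  apply/negPn/negP => nCy.
  exact: (lamG (val x) y A C B GA GC GB (sDA _ (valP x)) (sDA _ Dy)).
by apply/fsubsetPn; exists B; rewrite !inE /= GB ?(negPf nBx).
Qed.

(** Greedy selection of petals: if the root of a member [A] outside [K] lies in
    at most [m] members, deleting these leaves only members that meet [A] in
    exactly [K]. *)
Lemma sunflower_or_large_star K m t G :
  laminar G -> (forall A, A \in G -> K `<` A) -> t * m < #|` G| ->
  (exists P, [/\ P `<=` G, #|` P| = t.+1 & fsunflower P K]) \/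
  (exists2 x, x \notin K & m < #|` star G x|).
Proof.
elim: t G => [|t IH] G lamG KG ltG.
  have [A GA] : exists A, A \in G by apply/fset0Pn; rewrite -cardfs_gt0.
  left; exists [fset A]; split.
  - by rewrite fsub1set.
  - exact: cardfs1.
  - by move=> B C; rewrite !inE => /eqP-> /eqP->; rewrite eqxx.
have [A GA] : exists A, A \in G.
  by apply/fset0Pn; rewrite -cardfs_gt0; apply: leq_ltn_trans ltG.
have := KG A GA; rewrite fproperE => /andP[/fsubsetP sKA nsAK].
have [||x] := laminar_root _ _ (A `\` K) lamG GA; first exact: fsubsetDl.
  by rewrite fsetD_eq0.
rewrite inE => /andP[nKx Ax] rootx.
have [lt_m | le_m] := ltnP m #|` star G x|; first by right; exists x.
have sG'G : [fset B in G | x \notin B] `<=` G.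
  by apply/fsubsetP => B; rewrite !inE => /andP[].
have [| B /(fsubsetP sG'G) /KG //|||] := IH [fset B in G | x \notin B].
- exact: laminar_sub sG'G lamG.
- move: ltG; rewrite mulSn (cardfs_sepC _ (fun B => x \in B)) => ltG.
  by rewrite -(ltn_add2l m); apply: leq_trans ltG _; rewrite leq_add2r.
- case=> P [/fsubsetP sPG' cardP sunP]; left; exists (A |` P).
  have PG B : B \in P -> (B \in G) /\ (x \notin B).
    by move=> /sPG'; rewrite !inE => /andP[].
  have meetA B : B \in P -> A `&` B = K.
    move=> /PG[GB nBx]; have /fproper_sub/fsubsetP sKB := KG B GB.
    apply/fsetP => y; rewrite inE; apply/andP/idP => [[Ay By]|Ky].
      apply: contraNT nBx => nKy; apply: rootx GB _ By.
      by rewrite inE nKy.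
    by rewrite sKA ?sKB.
  split.
  + by apply/fsubsetP => B; rewrite !inE => /orP[/eqP-> | /PG[]].
  + have nPA : A \notin P by apply/negP => /PG[_]; rewrite Ax.
    by rewrite cardfsU1 nPA cardP.
  + move=> B C; rewrite !inE => /orP[/eqP->|PB] /orP[/eqP->|PC] neqBC.
    * by rewrite eqxx in neqBC.
    * exact: meetA.
    * by rewrite fsetIC; apply: meetA.
    * exact: sunP.
- case=> y nKy lt_m; right; exists y => //; apply: leq_trans lt_m _.
  apply: fsubset_leq_card; apply/fsubsetP => B.
  by rewrite !inE /= => /andP[/andP[-> _] ->].
Qed.

(** Induction on the number [n] of points of each member outside the kernel
    [K]: a large star is a family with one more kernel point. *)
Lemma laminar_sunflower s n K G :
  laminar G -> (forall A, A \in G -> (K `<=` A) /\ #|` A| = (#|` K| + n)%N) ->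
  s ^ n < #|` G| ->
  exists P K', [/\ P `<=` G, #|` P| = s.+1 & fsunflower P K'].
Proof.
elim: n K G => [|n IH] K G lamG KG ltG.
  have: G `<=` [fset K].
    apply/fsubsetP => A /KG[sKA cardA]; rewrite inE eq_sym eqEfcard sKA.
    by rewrite cardA addn0 leqnn.
  by move=> /fsubset_leq_card; rewrite cardfs1 leqNgt ltG.
have KltG A : A \in G -> K `<` A.
  by move=> /KG[sKA cardA]; rewrite fproperEcard sKA cardA addnS ltnS leq_addr.
rewrite expnS in ltG.
have [[P [sPG cardP sunP]] | [x nKx ltx]] :=
    sunflower_or_large_star _ _ _ _ lamG KltG ltG.
  by exists P, K.
have sG : star G x `<=` G by apply/fsubsetP => A; rewrite !inE => /andP[].
have [||P [K' [sP cardP sunP]]] := IH (x |` K) (star G x) _ _ ltx.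
- exact: laminar_sub sG lamG.
- move=> A; rewrite !inE => /andP[/KG[sKA cardA] Ax]; split.
    by rewrite fsubUset fsub1set Ax.
  by rewrite cardfsU1 nKx cardA addnS.
by exists P, K'; split=> //; apply: fsubset_trans sP sG.
Qed.

(** * Families that shatter no pair *)

Lemma laminar_off_member (F : set {fset V}) A0 G :
  (forall S, shatters F S -> #|` S| <= 1) -> F A0 ->
  (forall A, A \in G -> F A) ->
  (forall A B, A \in G -> B \in G -> A `&` A0 = B `&` A0) -> laminar G.
Proof.
move=> vcF FA0 GF eqG x y A B C GA GB GC Ax Ay Bx nBy nCx Cy.
(* Members of [G] agree on [A0], so a point on which two of them differ is
   outside [A0]. *)
have offA0 z X Y : X \in G -> Y \in G -> z \in X -> z \notin Y -> z \notin A0.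
  move=> GX GY Xz nYz; apply/negP => A0z.
  by have /fsetP/(_ z) := eqG X Y GX GY; rewrite !inE Xz A0z (negPf nYz).
have nA0x := offA0 x B C GB GC Bx nCx.
have nA0y := offA0 y C B GC GB Cy nBy.
have neq_xy : x != y by apply: contraNneq nBy => <-.
suff /vcF : shatters F [fset x; y] by rewrite cardfs2 neq_xy.
have traceE X (D : {fset V}) : D `<=` [fset x; y] ->
    (x \in X) = (x \in D) -> (y \in X) = (y \in D) -> X `&` [fset x; y] = D.
  move=> /fsubsetP sD ex ey; apply/fsetP => z; rewrite inE.
  apply/andP/idP => [[Xz]|Dz].
    by rewrite !inE => /orP[] /eqP ezz; move: Xz; rewrite ezz ?ex ?ey.
  have := sD z Dz; rewrite !inE => zxy; split=> //.
  by case/orP: zxy Dz => /eqP->; rewrite ?ex ?ey.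
move=> D sD; case: (boolP (x \in D)) (boolP (y \in D)) => [Dx|nDx] [Dy|nDy].
- exists A; split; first exact: GF.
  by apply: traceE => //; rewrite ?Ax ?Ay ?Dx ?Dy.
- exists B; split; first exact: GF.
  by apply: traceE => //; rewrite ?Bx ?(negPf nBy) ?Dx ?(negPf nDy).
- exists C; split; first exact: GF.
  by apply: traceE => //; rewrite ?Cy ?(negPf nCx) ?Dy ?(negPf nDx).
- exists A0; split=> //.
  by apply: traceE => //; rewrite ?(negPf nA0x, negPf nA0y, negPf nDx, negPf nDy).
Qed.

Lemma finite_subfamily (F : set {fset V}) (m : nat) :
  card_at_least F m ->
  exists2 G, (forall A, A \in G -> F A) & #|` G| = m.
Proof.
move=> /card_leP[f].
pose g (i : 'I_m) := val (f (exist _ (nat_of_ord i) (mem_set (ltn_ord i)))).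
have g_inj : injective g.
  move=> i j /val_inj /(@inj _ _ _ f) eqij.
  by apply/val_inj; have := eqij (mem_set I) (mem_set I) => -[].
exists [fset g i | i in 'I_m].
  by move=> A /imfsetP[i _ ->]; apply: set_mem; apply: valP.
by rewrite card_imfset //= size_enum_ord.
Qed.

Lemma has_sunflower_fset (F : set {fset V}) (r : nat) P K :
  (forall A, A \in P -> F A) -> #|` P| = r -> fsunflower P K ->
  has_sunflower r F.
Proof.
move=> PF cardP sunP.
pose S (i : 'I_r) := nth fset0 (enum_fset P) i.
have SP i : S i \in P by apply: mem_nth; rewrite [X in _ < X]cardP.
have Sinj : injective S.
  move=> i j /eqP; rewrite nth_uniq ?fset_uniq ?cardP //.
  by move=> /eqP/val_inj.
exists S; split=> [i|]; first exact: PF.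
split=> // i j i' j' neq neq'.
by rewrite !sunP ?(inj_eq Sinj).
Qed.

Lemma large_family_sunflower (F : set {fset V}) (k s : nat) :
  uniform_family k F -> (forall S, shatters F S -> #|` S| <= 1) ->
  card_at_least F (2 ^ k * s.+1 ^ k).+1 -> has_sunflower s.+2 F.
Proof.
move=> unifF vcF /finite_subfamily[G GF cardG].
have [A0 GA0] : exists A0, A0 \in G by apply/fset0Pn; rewrite -cardfs_gt0 cardG.
have [||T] := fset_pigeonhole _ _ (fun A => A `&` A0) G (fpowerset A0)
    (s.+1 ^ k).
- by move=> A _; rewrite fpowersetE fsubsetIr.
- by rewrite card_fpowerset cardG (unifF A0) //; apply: GF.
set H := (X in #|` X|) => ltH.
have HG A : A \in H -> A \in G /\ A `&` A0 = T.
  by rewrite !inE => /andP[? /eqP].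
have HF A : A \in H -> F A by move=> /HG[/GF].
have lamH : laminar H.
  apply: laminar_off_member vcF (GF _ GA0) HF _.
  by move=> A B /HG[_ ->] /HG[_ ->].
have [||P [K [/fsubsetP sPH cardP sunP]]] :=
    laminar_sunflower s.+1 (k - #|` T|) T H lamH.
- move=> A HA; have [_ eqT] := HG A HA.
  have sTA : T `<=` A by rewrite -eqT fsubsetIl.
  split=> //; rewrite (unifF A (HF A HA)) subnKC //.
  by rewrite -(unifF A (HF A HA)) fsubset_leq_card.
- by apply: leq_ltn_trans ltH; rewrite leq_pexp2l // leq_subr.
by apply: has_sunflower_fset cardP sunP => A /sPH/HF.
Qed.

End LaminarSunflower.

Lemma sunflower_threshold_lt (r k : nat) :
  2 <= r -> 1 <= k -> 2 ^ k * r.-1 ^ k < r ^ (10 * k).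
Proof.
move=> r2 k1.
have r0 : 0 < r by apply: leq_trans r2.
apply: (@leq_ltn_trans (r ^ (2 * k))).
  by rewrite mul2n -addnn expnD leq_mul // leq_exp2r // leq_pred.
by rewrite ltn_exp2l // ltn_mul2r k1.
Qed.

Theorem theorem1p2 (r k : nat) (hr : 3 <= r) (hk : 1 <= k) :
  (forall (V : choiceType) (F : set {fset V}),
     uniform_family k F -> vc_dim F 1 -> card_at_least F (r ^ (10 * k)) ->
     has_sunflower r F) /\
  (exists m : nat, sunflower_number 1 r k m /\ m <= r ^ (10 * k)).
Proof.
have sunflower_of (V : choiceType) (F : set {fset V}) :
    uniform_family k F -> (forall S, shatters F S -> #|` S|%fset <= 1) ->
    card_at_least F (r ^ (10 * k)) -> has_sunflower r F.
  move=> unifF vcF cardF; case: r hr cardF => [|[|s]] // _ cardF.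
  apply: large_family_sunflower unifF vcF _.
  apply: card_le_trans cardF; rewrite card_le_II.
  exact: sunflower_threshold_lt.
split=> [V F unifF [_ vcF] | ]; first exact: sunflower_of.
have forces : forces_sunflower 1 r k (r ^ (10 * k)).
  move=> V F unifF cardF [e [[_ vcF] e1]].
  apply: sunflower_of => // S /vcF leSe; exact: leq_trans leSe e1.
have r_gt0 : 0 < r ^ (10 * k) by rewrite expn_gt0 (leq_trans _ hr).
pose p m := `[< 0 < m /\ forces_sunflower 1 r k m >].
have p_bound : p (r ^ (10 * k)) by apply/asboolP.
have p_ex : exists m, p m by exists (r ^ (10 * k)).
exists (ex_minn p_ex); case: ex_minnP => m /asboolP[m_gt0 forces_m] min_m.
split; last exact: min_m.
by split=> // m' m'_gt0 forces_m'; apply: min_m; apply/asboolP.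
Qed.
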